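(* In the setting of the context (a weighted genus two admissible cover over the standard log point, with real-metrised tropicalisation $\Gamma$, associated function $\lambda$, and $\rho_1$ the value of $\lambda$ on the special vertex or vertices), the subcurve $\Gamma_{\ge\rho_1}=\{x\in\Gamma:\lambda(x)\ge\rho_1\}$ is connected.
   Context: *Admissible cover.* Over $\mathbb C$, let $\psi\colon(C,D_R)\to(T,D_B)$ be a hyperelliptic admissible cover: a finite degree two morphism of nodal curves, $C$ connected of arithmetic genus $2$, $T$ of genus $0$, étale on $C^{sm}\setminus D_R$, simply ramified along the six smooth points $D_R$ mapping to six distinct smooth points $D_B$, mapping nodes to nodes with the same ramification order $1$ or $2$ on both branches. It carries a weight $w\colon V(\Gamma)\to\mathbb N$ on the dual graph of $C$, not identically zero, such that with $w_T(v)=\sum_{v'\mapsto v}w(v')$ every component of $T$ with $w_T=0$ has at least three nodes or branch points. *Metric.* $\Gamma=\mathrm{trop}(C)$ and the tree $\Gamma_T=\mathrm{trop}(T)$ are the dual graphs with positive real edge lengths, where the length of an edge of $\Gamma_T$ is the ramification order (expansion factor) times the length of any edge of $\Gamma$ above it; $\mathrm{trop}(\psi)\colon\Gamma\to\Gamma_T$ is the induced harmonic map of degree two. For a subcurve, genus means arithmetic genus: first Betti number plus sum of vertex genera. *Functions.* A piecewise linear (PL) function has integral slopes on (a subdivision of) $\Gamma$ (half-integral slopes allowed on $\Gamma_T$); $\mathrm{div}(\lambda)(v)$ is the sum of outgoing slopes at $v$; $K_\Gamma(v)=2g(v)-2+\mathrm{val}(v)$. Pullback along $\mathrm{trop}(\psi)$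 composes functions and multiplies divisors by local degrees. On $\Gamma_T$ let $D'(v)=\mathrm{val}(v)-2+\tfrac12\deg(D_B|_v)$ (valence counts edges only); it has degree $1$ and pulls back to $K_\Gamma$. For each vertex $v_0$ of $\Gamma_T$ there is a PL function $\overline\lambda_T$, unique up to constants, with $D'+\mathrm{div}(\overline\lambda_T)=v_0$; its pullback to $\Gamma$ is an *admissible function*. Let $\overline\lambda_1,\dots,\overline\lambda_s$ be all of them and let $\lambda_i$ be $\overline\lambda_i$ shifted by a constant so that vertices with $\lambda_i>0$ have weight $0$ while those with $\lambda_i\ge0$ have total weight $\ge1$ (i.e. the maximum of $\lambda_i$ on vertices of positive weight is $0$). Define $\lambda=\max\{0,\lambda_1,\dots,\lambda_s\}$, a PL function on a subdivision of $\Gamma$, pulled back from $\lambda_T$ on $\Gamma_T$. Put $\Delta^\circ=\{\lambda>0\}$ and let $\Delta$ be the minimal subcurve of genus two containing the closure of $\Delta^\circ$, $\Delta_T$ its image in $\Gamma_T$. With $D'$ computed using valences in $\Delta_T$, $D=D'+\mathrm{div}(\lambda_T)$ is an effective divisor of degree $1$ with half-integral coefficients on $\Delta_T$ and $\mathrm{trop}(\psi)^*D=K_\Delta+\mathrm{div}(\lambda)$ on $\Delta$. The point(s) supporting $D$, and their preimages in $\Gamma$, are called special; if $D$ is half the sum of two distinct points then $\lambda$ is $0$ at both, so the value $\rho_1\ge0$ of $\lambda$ on the special vertex(ices) is well defined.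
   Formalization: In D' on Δ_T the branch divisor also counts, with coefficient 1/2, each ramified edge direction along which Δ_T is cut off; without this term D need not have degree 1 or pull back to K_Δ+div(λ), and special points may fail to exist. *)

(* Defs.v *)
From HB Require Import structures.
From mathcomp Require Import all_boot all_order all_algebra.
From mathcomp Require Import all_classical all_reals all_analysis.
Set Implicit Arguments.
Unset Strict Implicit.
Unset Printing Implicit Defensive.
Import Order.TTheory GRing.Theory Num.Theory.
Import numFieldNormedType.Exports.
Local Open Scope classical_set_scope.
Local Open Scope ring_scope.

(* The orientation [src -> tgt] of the edges is auxiliary: it only serves to
   parametrise the edge [e] by the interval [0, len e]. *)
Record tropcurve (R : realType) := TropCurve {
  vertex : finType;
  edge : finType;
  src : edge -> vertex;
  tgt : edge -> vertex;
  len : edge -> R;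
  len_gt0 : forall e, 0 < len e;
  vgenus : vertex -> nat }.

(* [(e, true)] is [e] leaving its source, [(e, false)] is [e] leaving its
   target.  A loop has two half-edges at its vertex. *)
Definition origin (R : realType) (G : tropcurve R) (d : edge G * bool) :
    vertex G :=
  if d.2 then src d.1 else tgt d.1.

Definition vval (R : realType) (G : tropcurve R) (v : vertex G) : nat :=
  #|[pred d : edge G * bool | origin d == v]|.

(* The points of the metric graph: its vertices, and the interior points of its
   edges, given by the distance to the source. *)
Definition pt (R : realType) (G : tropcurve R) : Type :=
  (vertex G + {e : edge G & {t : R | 0 < t < len e}})%type.

HB.instance Definition _ (R : realType) (G : tropcurve R) :=
  Choice.copy (pt G) (vertex G + {e : edge G & {t : R | 0 < t < len e}})%type.

Definition vpt (R : realType) (G : tropcurve R) (v : vertex G) : pt G := inl v.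

(* The parametrisation [0, len e] -> G of the closed edge [e], extended to R by
   constants on both sides. *)
Definition epoint (R : realType) (G : tropcurve R) (e : edge G) (t : R) : pt G :=
  match insub t : option {t : R | 0 < t < len e} with
  | Some u => inr (existT _ e u)
  | None => if t <= 0 then inl (src e) else inl (tgt e)
  end.

(* The topology of the metric graph is the quotient topology of the disjoint
   union of the vertices and of the closed edges: the final topology with
   respect to the parametrisations of the edges. *)
Definition pt_open (R : realType) (G : tropcurve R) : set_system (pt G) :=
  [set U | forall e : edge G, open (epoint e @^-1` U)].

Lemma pt_openT (R : realType) (G : tropcurve R) : pt_open [set: pt G].
Proof. by move=> e; rewrite preimage_setT; exact: openT. Qed.

Lemma pt_openI (R : realType) (G : tropcurve R) : setI_closed (@pt_open R G).
Proof. by move=> A B oA oB e; rewrite preimage_setI; exact: openI. Qed.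

Lemma pt_open_bigU (R : realType) (G : tropcurve R) (I : Type)
    (f : I -> set (pt G)) :
  (forall i, pt_open (f i)) -> pt_open (\bigcup_i f i).
Proof.
by move=> of_ e; rewrite preimage_bigcup; apply: bigcup_open => i _; exact: of_.
Qed.

HB.instance Definition _ (R : realType) (G : tropcurve R) :=
  isOpenTopological.Build (pt G)
    (@pt_openT R G) (@pt_openI R G) (@pt_open_bigU R G).

(* The tangent directions at a point, as oriented edges: all half-edges issuing
   from a vertex, or the two orientations of the edge through an interior
   point. *)
Definition tangent (R : realType) (G : tropcurve R) (x : pt G) :
    pred (edge G * bool) :=
  fun d => match x with
           | inl v => origin d == v
           | inr (existT e _) => d.1 == e
           end.

Definition move (R : realType) (G : tropcurve R) (x : pt G)
    (d : edge G * bool) (eps : R) : pt G :=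
  match x with
  | inl _ => epoint d.1 (if d.2 then eps else len d.1 - eps)
  | inr (existT e t) => epoint e (if d.2 then val t + eps else val t - eps)
  end.

Definition tangent_in (R : realType) (G : tropcurve R) (A : set (pt G))
    (x : pt G) : pred (edge G * bool) :=
  fun d => tangent x d && `[< \forall eps \near 0^'+, A (move x d eps) >].

Definition valence_in (R : realType) (G : tropcurve R) (A : set (pt G))
    (x : pt G) : nat :=
  #|[pred d | tangent_in A x d]|.

Definition slope (R : realType) (G : tropcurve R) (f : pt G -> R) (x : pt G)
    (d : edge G * bool) : R :=
  lim ((f (move x d eps) - f x) / eps @[eps --> 0^'+]).

(* div of the restriction of [f] to the subcurve [A], at a point of [A] *)
Definition div_in (R : realType) (G : tropcurve R) (A : set (pt G))
    (f : pt G -> R) (x : pt G) : R :=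
  \sum_(d | tangent_in A x d) slope f x d.

Definition half_integral (R : realType) (a : R) : Prop :=
  exists z : int, a = z%:~R / 2.

(* Continuity is built in: consecutive closed pieces share their end points, and
   all edges at a vertex share this vertex. *)
Definition PL_half (R : realType) (G : tropcurve R) (f : pt G -> R) : Prop :=
  forall e : edge G, exists s : seq R,
    [/\ path <%R 0 s, last 0 s = len e &
        forall i, (i < size s)%N -> exists2 a, half_integral a &
          forall t, nth 0 (0 :: s) i <= t <= nth 0 s i ->
            f (epoint e t) =
              f (epoint e (nth 0 (0 :: s) i)) + a * (t - nth 0 (0 :: s) i)].

(* Subgraphs of subdivisions.  On each edge, such a set is a finite union of
   closed intervals, possibly reduced to points. *)
Definition subcurve (R : realType) (G : tropcurve R) (A : set (pt G)) : Prop :=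
  forall e : edge G, exists s : seq (R * R),
    forall t, 0 <= t <= len e ->
      (A (epoint e t) <-> has (fun p : R * R => p.1 <= t <= p.2) s).

Definition vertex_in (R : realType) (G : tropcurve R) (A : set (pt G)) :
    pred (vertex G) :=
  fun v => `[< A (vpt v) >].

Definition edge_in (R : realType) (G : tropcurve R) (A : set (pt G)) :
    pred (edge G) :=
  fun e => `[< forall t, 0 <= t <= len e -> A (epoint e t) >].

Definition adj_in (R : realType) (G : tropcurve R) (A : set (pt G)) :
    rel (vertex G) :=
  fun u v => [exists e, edge_in A e &&
    (((src e == u) && (tgt e == v)) || ((src e == v) && (tgt e == u)))].

(* First Betti number of a subcurve.  The partial edges of [A] are dropped: they
   are disjoint from all cycles, being segments attached at one end at most.
   The truncated subtraction is a genuine one. *)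
Definition betti1 (R : realType) (G : tropcurve R) (A : set (pt G)) : nat :=
  (#|[pred e | edge_in A e]| + n_comp (adj_in A) [pred v | vertex_in A v]
   - #|[pred v | vertex_in A v]|)%N.

Definition genus (R : realType) (G : tropcurve R) (A : set (pt G)) : nat :=
  (betti1 A + \sum_(v | vertex_in A v) vgenus v)%N.

(* Connectedness of the dual graph, i.e. of the nodal curve. *)
Definition gconnected (R : realType) (G : tropcurve R) : Prop :=
  forall u v : vertex G, connect (adj_in [set: pt G]) u v.

(* The tropical data of a hyperelliptic admissible cover psi : C -> T.
   Vertices are the components of C and T, edges are the nodes; [C] is oriented
   so that trop(psi) preserves the orientations. [ldeg v] is the degree of psi
   on the component [v], [ram e] its ramification order at the node [e], and
   [drpt i], [dbpt i] are the components carrying the i-th point of D_R and its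
   image in D_B. *)
Record hypcover (R : realType) := HypCover {
  C : tropcurve R;
  T : tropcurve R;
  vmap : vertex C -> vertex T;
  emap : edge C -> edge T;
  vmap_src : forall e, vmap (src e) = src (emap e);
  vmap_tgt : forall e, vmap (tgt e) = tgt (emap e);
  ldeg : vertex C -> nat;
  ldeg_gt0 : forall v, (0 < ldeg v)%N;
  ldeg_sum : forall u : vertex T, (\sum_(v | vmap v == u) ldeg v = 2)%N;
  ram : edge C -> nat;
  ram12 : forall e, ram e = 1%N \/ ram e = 2%N;
  len_emap : forall e, len (emap e) = (ram e)%:R * len e;
  (* the fibre of the component v over a node a of its image has degree ldeg v *)
  harmonic : forall (v : vertex C) (a : edge T * bool), origin a = vmap v ->
    (\sum_(d : edge C * bool | (origin d == v) && ((emap d.1, d.2) == a))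
        ram d.1 = ldeg v)%N;
  drpt : 'I_6 -> vertex C;
  dbpt : 'I_6 -> vertex T;
  vmap_drpt : forall i, vmap (drpt i) = dbpt i;
  ldeg_drpt : forall i, ldeg (drpt i) = 2%N;
  (* psi is etale on the smooth locus outside of D_R and simply ramified along
     D_R, so that Riemann-Hurwitz on the component v reads as follows *)
  riemann_hurwitz : forall v : vertex C,
    2 * (vgenus v)%:Z - 2 =
      (ldeg v)%:Z * (2 * (vgenus (vmap v))%:Z - 2)
      + (#|[pred i | drpt i == v]|)%:Z
      + \sum_(d : edge C * bool | origin d == v) ((ram d.1)%:Z - 1);
  C_connected : gconnected C;
  C_genus : genus [set: pt C] = 2%N;
  T_connected : gconnected T;
  T_genus : genus [set: pt T] = 0%N }.

Arguments vmap {R h}.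
Arguments emap {R h}.
Arguments ldeg {R h}.
Arguments ram {R h}.
Arguments drpt {R h}.
Arguments dbpt {R h}.

Definition nbranch (R : realType) (X : hypcover R) (u : vertex (T X)) : nat :=
  #|[pred i | dbpt i == u]|.

Definition is_weight (R : realType) (X : hypcover R)
    (w : vertex (C X) -> nat) : Prop :=
  (exists v, w v <> 0%N) /\
  forall u : vertex (T X), (\sum_(v | vmap v == u) w v = 0)%N ->
    (3 <= vval u + nbranch u)%N.

Definition trop (R : realType) (X : hypcover R) (x : pt (C X)) : pt (T X) :=
  match x with
  | inl v => vpt (vmap v)
  | inr (existT e t) => epoint (emap e) ((ram e)%:R * val t)
  end.

(* Directions at a point of a subcurve [A] of Gamma_T, leading out of [A], over
   which psi is ramified. *)
Definition cut_ramified (R : realType) (X : hypcover R) (A : set (pt (T X)))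
    (x : pt (T X)) : nat :=
  #|[pred d : edge (T X) * bool | [&& tangent x d, ~~ tangent_in A x d &
      [exists e : edge (C X), (emap e == d.1) && (ram e == 2%N)]]]|.

(* The divisor D' of a subcurve [A] of Gamma_T, at the points of [A].  The branch
   divisor of the restriction of psi to a double cover of [A] consists of D_B and
   of the ramified nodes at which [A] has been cut off from Gamma_T; this is
   what makes D' of degree 1, with pull-back the canonical divisor, when the
   cover of [A] has genus two.  For [A] the whole of Gamma_T no edge is cut and
   D'(v) = val(v) - 2 + deg(D_B|v)/2. *)
Definition Dprime (R : realType) (X : hypcover R) (A : set (pt (T X)))
    (x : pt (T X)) : R :=
  (valence_in A x)%:R - 2
  + ((if x is inl u then nbranch u else 0%N) + cut_ramified A x)%:R / 2.

Definition admissible (R : realType) (X : hypcover R) (v0 : vertex (T X))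
    (f : pt (T X) -> R) : Prop :=
  PL_half f /\
  forall x, Dprime [set: pt (T X)] x + div_in [set: pt (T X)] f x
            = (x == vpt v0)%:R.

Definition normalized (R : realType) (X : hypcover R) (w : vertex (C X) -> nat)
    (f : pt (C X) -> R) : Prop :=
  (forall v, 0 < f (vpt v) -> w v = 0%N) /\
  (1 <= \sum_(v | (0 <= f (vpt v))%R) w v)%N.

(* [ls v0] is the normalised admissible function attached to [v0], as a function
   on Gamma_T. *)
Definition lambdaT (R : realType) (X : hypcover R)
    (ls : vertex (T X) -> pt (T X) -> R) (x : pt (T X)) : R :=
  \big[Num.max/0]_(v0 : vertex (T X)) ls v0 x.

Definition lambda (R : realType) (X : hypcover R)
    (ls : vertex (T X) -> pt (T X) -> R) (x : pt (C X)) : R :=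
  lambdaT ls (trop x).

(* Arithmetic genus is that of connected subcurves; the connected subcurves of
   genus two containing a given set have a smallest element, since they all
   contain the core of Gamma and Gamma retracts onto its core along trees. *)
Definition Delta (R : realType) (X : hypcover R)
    (ls : vertex (T X) -> pt (T X) -> R) : set (pt (C X)) :=
  smallest [set A | [/\ subcurve A, connected A & genus A = 2%N]]
    (closure [set x | 0 < lambda ls x]).

Definition DeltaT (R : realType) (X : hypcover R)
    (ls : vertex (T X) -> pt (T X) -> R) : set (pt (T X)) :=
  @trop R X @` Delta ls.

Definition D (R : realType) (X : hypcover R)
    (ls : vertex (T X) -> pt (T X) -> R) (x : pt (T X)) : R :=
  Dprime (DeltaT ls) x + div_in (DeltaT ls) (lambdaT ls) x.

Definition special (R : realType) (X : hypcover R)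
    (ls : vertex (T X) -> pt (T X) -> R) (x : pt (C X)) : Prop :=
  DeltaT ls (trop x) /\ D ls (trop x) <> 0.

Definition special_value (R : realType) (X : hypcover R)
    (ls : vertex (T X) -> pt (T X) -> R) (rho1 : R) : Prop :=
  exists2 x, special ls x & lambda ls x = rho1.

(* Main.v *)
(** On the tree [T X], every [ls v0] is affine along the edges, with slope
    [b / 2 - 1 - n] in the direction [d], where [b] counts the branch points lying
    beyond [d] and [n] is 1 if [v0] lies beyond [d] and 0 otherwise.

    If the special value [rho1] is 0 then the superlevel set is the whole graph.
    Otherwise let [y] be the image of a special vertex.  As [lambda] is positive
    near [y], so that [Delta] contains a neighbourhood of the fibre, [D] may be
    computed at [y] in all of [T X].  That it does not vanish there means that for
    every direction [d] at [y] some [v0] with [ls v0] maximal at [y] is not beyond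
    [d].  Moving away from [y], the superlevel set [K] of [lambdaT ls] contains
    every edge with [b >= 2], while along the edges with [b <= 2] all the [ls v0]
    are nonincreasing; so [K] is star-shaped around [y].

    Paths of the tree lift to the double cover, so the preimage of [K] is
    connected as soon as [K] contains a vertex with a single preimage.  Such a
    vertex is found beyond [y] by following the edges with [b >= 2]: by
    Riemann-Hurwitz an edge is ramified exactly when [b] is odd, so the last of
    these edges ends at a branch point or at the origin of an edge with [b = 1]. *)

Require Import Defs.
From mathcomp Require Import all_boot all_order all_algebra.
From mathcomp Require Import all_classical all_reals all_analysis.
From mathcomp Require Import lra zify.
Set Implicit Arguments.
Unset Strict Implicit.
Unset Printing Implicit Defensive.
Import Order.TTheory GRing.Theory Num.Theory.
Import numFieldNormedType.Exports.
Local Open Scope classical_set_scope.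
Local Open Scope ring_scope.

(** * Half-edges of a tree *)

Section HalfEdges.
Variables (R : realType) (G : tropcurve R).
Implicit Types (d : edge G * bool) (u v : vertex G).

Definition flip d : edge G * bool := (d.1, ~~ d.2).

Definition target d : vertex G := origin (flip d).

Definition onward : rel (edge G * bool) :=
  fun d d' => (origin d' == target d) && (d' != flip d).

Lemma flipK : involutive flip.
Proof. by case=> e b; rewrite /flip /= negbK. Qed.

Lemma target_flip d : target (flip d) = origin d.
Proof. by rewrite /target flipK. Qed.

Lemma same_edge d d' : d.1 = d'.1 -> d = d' \/ d = flip d'.
Proof.
by case: d d' => [e b] [e' b'] /= ->; case: b b' => [] []; [left|right|right|left].
Qed.

Lemma sum_onward (V : zmodType) (F : edge G * bool -> V) d :
  \sum_(d' | origin d' == target d) F d' = F (flip d) + \sum_(d' | onward d d') F d'.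
Proof. by rewrite (bigD1 (flip d)) ?eqxx. Qed.

Lemma sumn_onward (F : edge G * bool -> nat) d :
  (\sum_(d' | origin d' == target d) F d'
     = F (flip d) + \sum_(d' | onward d d') F d')%N.
Proof. by rewrite (bigD1 (flip d)) ?eqxx. Qed.

Section Height.
Hypotheses (conn : gconnected G) (genus0 : genus [set: pt G] = 0%N).
Variable r : vertex G.

Let adj : rel (vertex G) :=
  fun u v => [exists d : edge G * bool, (origin d == u) && (target d == v)].

Let adjE : adj_in [set: pt G] =2 adj.
Proof.
move=> u v; apply/existsP/existsP => [[e /andP[_ /orP[]]]|[[e b] /= uv]].
- by move=> uv; exists (e, true).
- by rewrite andbC => uv; exists (e, false).
- exists e; apply/andP; split; first exact/asboolT.
  by move: uv; rewrite /target /origin /=; case: b => /= ?; apply/orP;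
    [left|right; rewrite andbC].
Qed.

Let adj_sym : symmetric adj.
Proof.
by move=> u v; apply/existsP/existsP => -[d uv]; exists (flip d);
  rewrite target_flip andbC.
Qed.

Let ball k : pred (vertex G) :=
  iter k (fun S v => S v || [exists u, S u && adj u v]) (pred1 r).

Let ballP v : exists k, ball k v.
Proof.
have := conn r v; rewrite (eq_connect adjE) => /connectP[p rp ->].
exists (size p); elim/last_ind: p rp => [|p z IH]; first by rewrite /= /ball /=.
rewrite rcons_path last_rcons size_rcons => /andP[/IH {}IH pz].
by apply/orP; right; apply/existsP; exists (last r p); apply/andP.
Qed.

Let dist v := ex_minn (ballP v).

Let down d := (dist (target d) < dist (origin d))%N.

Let dist_down v : v != r -> exists2 d, origin d = v & down d.
Proof.
rewrite /down; case E : (dist v) => [|k] vr.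
  by move: E vr; rewrite /dist; case: ex_minnP => -[|//] /= /eqP->; rewrite eqxx.
have [vk kmin] : ball k.+1 v /\ forall n, ball n v -> (k.+1 <= n)%N.
  by move: E; rewrite /dist; case: ex_minnP => m vm mmin <-.
case/orP: vk => [/kmin|]; first by rewrite ltnn.
case/existsP => u /andP[uk]; rewrite adj_sym => /existsP[d /andP[/eqP dv /eqP du]].
exists d; rewrite // dv E du ltnS /dist; case: ex_minnP => m _; exact.
Qed.

Let tree_edges : (#|edge G| < #|vertex G|)%N.
Proof.
move: genus0; rewrite /genus /betti1 => /eqP; rewrite addn_eq0 => /andP[/eqP + _].
rewrite (_ : #|[pred e | edge_in _ e]| = #|edge G|); last first.
  by apply: eq_card => e; rewrite !inE; apply/asboolP.
rewrite (_ : #|[pred v | vertex_in _ v]| = #|vertex G|); last first.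
  by apply: eq_card => e; rewrite !inE; apply/asboolP.
suff : (0 < n_comp (adj_in [set: pt G]) [pred v | vertex_in [set: pt G] v])%N by lia.
apply/card_gt0P; exists (fingraph.root (adj_in [set: pt G]) r).
rewrite !inE; apply/andP; split; last exact/asboolP.
apply: roots_root; apply: sym_connect_sym => u v; rewrite !adjE; exact: adj_sym.
Qed.

(* In a tree with [n] vertices, sending a vertex to the edge leading to the root
   is injective, hence by counting a bijection from the other vertices to the
   edges. *)
Lemma tree_height : exists ht : edge G * bool -> nat,
  forall d d', onward d d' -> (ht d' < ht d)%N.
Proof.
have fst_inj : {in [pred d | down d] &, injective (@fst (edge G) bool)}.
  move=> d d'; rewrite !inE => dd dd' /same_edge[//|dE].
  by move: dd dd'; rewrite dE /down target_flip -/(target d') => /ltn_trans/[apply];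
    rewrite ltnn.
have cardV : (#|vertex G|.-1 <= #|fintype.image (@origin _ G) [pred d | down d]|)%N.
  have <- : #|predC1 r| = #|vertex G|.-1 by rewrite -(cardC1 r).
  apply/subset_leq_card/fintype.subsetP => v; rewrite !inE => /dist_down[d <- dd].
  by apply/fintype.imageP; exists d.
have edgeV : (#|edge G| <= #|vertex G|.-1)%N by move: tree_edges; lia.
have cardD : (#|[pred d | down d]| <= #|edge G|)%N.
  by rewrite -(card_in_image fst_inj) max_card.
have origin_inj : {in [pred d | down d] &, injective (@origin _ G)}.
  apply/image_injP; rewrite eqn_leq leq_image_card /=.
  exact: leq_trans cardD (leq_trans edgeV cardV).
have downVflip d : down d || down (flip d).
  have : d.1 \in fintype.image (@fst (edge G) bool) [pred d | down d].
    suff /subset_cardP/(_ (subset_predT _)) -> :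
        #|fintype.image (@fst (edge G) bool) [pred d | down d]| = #|edge G| by [].
    apply/eqP; rewrite (card_in_image fst_inj) eqn_leq cardD /=.
    exact: leq_trans edgeV (leq_trans cardV (leq_image_card _ _)).
  case/fintype.imageP => d'; rewrite inE => dd' /same_edge[->|->]; first by rewrite dd'.
  by rewrite flipK dd' orbT.
pose N := \max_v dist v.
exists (fun d => if down d then (N + dist (origin d))%N else (N - dist (target d))%N).
move=> d d' /andP[/eqP dd' ndd'].
have distN v : (dist v <= N)%N by apply: leq_bigmax.
have [downd|ndownd] := boolP (down d).
  by move: (downd); rewrite /down -dd'; case: ifP; have := distN (target d'); lia.
have flipd : down (flip d) by move: (downVflip d); rewrite (negPf ndownd).
have ndownd' : ~~ down d'.
  by apply: contra ndd' => dd; apply/eqP/origin_inj; rewrite ?inE.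
have := downVflip d'; rewrite (negPf ndownd') /= /down target_flip.
rewrite -[origin (flip d')]/(target d') dd'.
by have := distN (target d'); lia.
Qed.
End Height.
End HalfEdges.

Arguments onward {R G}.

(** * Admissible functions are affine along edges *)

Section MetricGraph.
Variables (R : realType) (G : tropcurve R).
Implicit Types (d : edge G * bool) (f : pt G -> R).

Definition dpoint d (t : R) : pt G :=
  epoint d.1 (if d.2 then t else len d.1 - t).

Lemma epoint_inr (e : edge G) (u : {t : R | 0 < t < len e}) :
  epoint e (val u) = inr (existT _ e u).
Proof. by rewrite /epoint valK. Qed.

Lemma epoint_interior (e : edge G) t (te : 0 < t < len e) :
  epoint e t = inr (existT (fun e => {t : R | 0 < t < len e}) e (exist _ t te)).
Proof. by rewrite -epoint_inr. Qed.

Lemma epoint_le0 (e : edge G) t : t <= 0 -> epoint e t = vpt (src e).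
Proof.
by move=> t0; rewrite /epoint insubF ?t0 //; apply/negbTE; rewrite ltNge t0.
Qed.

Lemma epoint_ge_len (e : edge G) t : len e <= t -> epoint e t = vpt (tgt e).
Proof.
move=> lt; rewrite /epoint insubF; last by rewrite [t < _]ltNge lt andbF.
by rewrite leNgt (lt_le_trans (len_gt0 e) lt).
Qed.

Lemma dpoint0 d : dpoint d 0 = vpt (origin d).
Proof.
case: d => e []; rewrite /dpoint /origin /=; first exact: epoint_le0.
by rewrite subr0; exact: epoint_ge_len.
Qed.

Lemma dpoint_flip d t : dpoint (flip d) t = dpoint d (len d.1 - t).
Proof. by case: d => e []; rewrite /dpoint /= ?subKr. Qed.

Lemma dpoint_len d : dpoint d (len d.1) = vpt (target d).
Proof. by rewrite -(dpoint0 (flip d)) dpoint_flip subr0. Qed.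

Lemma tangent_dpoint (y : pt G) d : tangent y d ->
  exists t, [/\ 0 <= t < len d.1, y = dpoint d t &
                forall eps, move y d eps = dpoint d (t + eps)].
Proof.
case: y => [v /eqP <-|[e u]].
  exists 0; rewrite lexx len_gt0; split=> //; first by rewrite dpoint0.
  by move=> eps; rewrite add0r.
case: d => e' b /= /eqP -> {e'}; have /andP[u0 ul] := valP u.
case: b; [exists (val u)|exists (len e - val u)]; split; rewrite /dpoint /= ?subKr.
- by rewrite ltW.
- by rewrite epoint_inr.
- by [].
- by rewrite subr_ge0 ltW //= gtrBl.
- by rewrite epoint_inr.
- by move=> eps; congr (epoint _ _); lra.
Qed.

Lemma tangent_inT (x : pt G) : tangent_in [set: pt G] x =1 tangent x.
Proof.
move=> d; rewrite /tangent_in asboolT ?andbT //.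
by near=> eps.
Unshelve. all: by end_near. Qed.

Lemma slope_eq f (x : pt G) d a :
  (\forall eps \near 0^'+, f (move x d eps) = f x + a * eps) -> slope f x d = a.
Proof.
move=> fa; rewrite /slope; apply: cvg_lim => //; apply: cvg_near_cst.
near=> eps; have -> : f (move x d eps) = f x + a * eps by near: eps.
by rewrite addrAC subrr add0r mulfK // gt_eqF.
Unshelve. all: by end_near. Qed.

Lemma sum_edge (V : nmodType) (F : edge G * bool -> V) (e : edge G) :
  \sum_(d | d.1 == e) F d = F (e, true) + F (e, false).
Proof.
rewrite (bigD1 (e, true)) //= (bigD1 (e, false)) /= ?xpair_eqE ?eqxx // big1 ?addr0 //.
by case=> e' [] /andP[/andP[/eqP/= ->]]; rewrite eqxx.
Qed.

Definition affine (g : R -> R) x y a :=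
  forall t, x <= t <= y -> g t = g x + a * (t - x).

Lemma affine_glue (g : R -> R) (s : seq R) (t0 : R) :
  path <%R t0 s ->
  (forall i, (i < size s)%N -> exists a, affine g (nth 0 (t0 :: s) i) (nth 0 s i) a) ->
  (forall x y z a b, t0 <= x -> x < y -> y < z -> z <= last t0 s ->
     affine g x y a -> affine g y z b -> a = b) ->
  exists a, affine g t0 (last t0 s) a.
Proof.
elim: s t0 => [|t1 s IH] t0 /=.
  by exists 0 => t; rewrite -eq_le => /eqP <-; rewrite subrr mulr0 addr0.
move=> /andP[t01 t1s] pieces nokink.
have [a /= ga] := pieces 0%N isT.
have [||b gb] := IH _ t1s.
- by move=> i si; exact: (pieces i.+1).
- move=> x y z a' b' t1x; apply: nokink; exact: le_trans (ltW t01) t1x.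
case: s {IH pieces} => [|t2 s] in t1s nokink gb *; first by exists a.
move: t1s => /= /andP[t12 t2s].
have t2l : t2 <= last t2 s.
  have := order_path_min lt_trans t2s => /allP t2P.
  by have := mem_last t2 s; rewrite inE => /predU1P[->//|/t2P/ltW].
have ab : a = b.
  apply: (nokink t0 t1 t2) => // t /andP[t1t tt2].
  by apply: gb; rewrite t1t (le_trans tt2).
exists a => t /andP[t0t tl]; have [tt1|/ltW t1t] := leP t t1; first exact/ga/andP.
rewrite gb ?t1t // ga ?lexx ?(ltW t01) // -ab; lra.
Qed.

End MetricGraph.

Section Admissible.
Variables (R : realType) (X : hypcover R).
Implicit Types (d : edge (T X) * bool) (f : pt (T X) -> R).

Lemma cut_ramifiedT (x : pt (T X)) : cut_ramified [set: pt (T X)] x = 0%N.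
Proof. by apply: eq_card0 => d; rewrite !inE tangent_inT; case: tangent. Qed.

Lemma Dprime_inr e u : Dprime (X := X) [set: _] (inr (existT _ e u)) = 0.
Proof.
rewrite /Dprime cut_ramifiedT mul0r addr0 /valence_in -sum1_card.
under eq_bigl do rewrite inE tangent_inT /=.
by rewrite (sum_edge (fun=> 1%N)) subrr.
Qed.

Lemma Dprime_vpt u : Dprime [set: _] (vpt u) =
  (vval u)%:R - 2 + (nbranch (X := X) u)%:R / 2.
Proof.
rewrite /Dprime cut_ramifiedT addn0; congr (_%:R - _ + _).
by apply: eq_card => d; rewrite !inE tangent_inT.
Qed.

Lemma admissible_affine v0 f : admissible v0 f -> exists sl : edge (T X) * bool -> R,
  [/\ forall d (t : R), 0 <= t <= len d.1 -> f (dpoint d t) = f (dpoint d 0) + sl d * t,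
      forall d, sl (flip d) = - sl d &
      forall u, \sum_(d | origin d == u) sl d =
         (u == v0)%:R - ((vval u)%:R - 2 + (nbranch u)%:R / 2)].
Proof.
case=> PLf divf.
have /choice[sl slP] : forall e, exists a, affine (f \o epoint e) 0 (len e) a.
  move=> e; have [s [ps sE pieces]] := PLf e.
  rewrite -sE; apply: affine_glue => // [i /pieces[a _ fa]|x y z a b x0 xy yz zl fa fb].
    by exists a.
  have yin : 0 < y < len e by rewrite (le_lt_trans x0 xy) -sE (lt_le_trans yz zl).
  pose u : {t : R | 0 < t < len e} := exist _ y yin.
  have pE : inr (existT _ e u) = epoint e y by rewrite -epoint_inr.
  have st : slope f (inr (existT _ e u)) (e, true) = b.
    apply: slope_eq; near=> eps.
    rewrite -[move _ _ _]/(epoint e (y + eps)) pE.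
    have eps0 : 0 < eps by near: eps; exact: nbhs_right_gt.
    have epsz : eps < z - y by near: eps; apply: nbhs_right_lt; rewrite subr_gt0.
    by have := fb (y + eps); rewrite /= addrAC subrr add0r => ->; lra.
  have sf : slope f (inr (existT _ e u)) (e, false) = - a.
    apply: slope_eq; near=> eps.
    rewrite -[move _ _ _]/(epoint e (y - eps)) pE.
    have eps0 : 0 < eps by near: eps; exact: nbhs_right_gt.
    have epsx : eps < y - x by near: eps; apply: nbhs_right_lt; rewrite subr_gt0.
    have /= -> := fa (y - eps); last lra.
    by have /= -> := fa y; lra.
  move: (divf (inr (existT _ e u))); rewrite Dprime_inr add0r /div_in.
  rewrite (eq_bigl _ _ (tangent_inT _)) /= sum_edge st sf.
  by move=> /eqP; rewrite subr_eq0 => /eqP.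
pose sl' d := if d.2 then sl d.1 else - sl d.1.
have slE d t : 0 <= t <= len d.1 -> f (dpoint d t) = f (dpoint d 0) + sl' d * t.
  case: d => e b; rewrite /dpoint /sl' /= => te.
  have fe r : 0 <= r <= len e -> f (epoint e r) = f (epoint e 0) + sl e * r.
    by move=> re; have /= -> := slP e r re; rewrite subr0.
  have := len_gt0 e; case: b; rewrite ?subr0; first by rewrite (fe t).
  by move=> /ltW l0; rewrite (fe (len e - t)) ?(fe (len e)) ?lexx ?l0 //; lra.
exists sl'; split=> // [[e []]|u]; rewrite /sl' /= ?opprK //.
move: (divf (vpt u)); rewrite Dprime_vpt /div_in.
rewrite (eq_bigl _ _ (tangent_inT _)) /= (eq_bigr sl').
  by move=> <-; rewrite addrAC subrr add0r.
move=> d /eqP du; apply: slope_eq; near=> eps.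
have -> : move (vpt u) d eps = dpoint d eps by [].
rewrite slE; first by rewrite dpoint0 du.
apply/andP; split; first by near: eps; exact: nbhs_right_ge.
by near: eps; exact/nbhs_right_le/len_gt0.
Unshelve. all: by end_near. Qed.

End Admissible.

(** * Slopes of admissible functions *)

Section Beyond.
Variables (R : realType) (G : tropcurve R) (ht : edge G * bool -> nat).
Hypothesis htP : forall d d', onward d d' -> (ht d' < ht d)%N.
Implicit Types (d : edge G * bool) (v : vertex G).

Fixpoint beyond_rec k v d : nat :=
  if k is k'.+1
  then ((target d == v) + \sum_(d' | onward d d') beyond_rec k' v d')%N
  else 0%N.

(* The multiplicity with which [v] occurs beyond [d], that is, in the component
   of the tree minus the edge [d.1] containing [target d]. *)
Definition beyond v d := beyond_rec (ht d).+1 v d.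

Lemma beyondE v d :
  beyond v d = ((target d == v) + \sum_(d' | onward d d') beyond v d')%N.
Proof.
rewrite [LHS]/beyond [LHS]/=; congr addn; apply: eq_bigr => d' dd'.
suff stable k1 k2 d0 : (ht d0 < k1)%N -> (ht d0 < k2)%N ->
  beyond_rec k1 v d0 = beyond_rec k2 v d0 by apply: stable; rewrite ?htP.
elim: k1 k2 d0 => [|k1 IH] [|k2] d0 //=; rewrite !ltnS => h1 h2.
by congr addn; apply: eq_bigr => d1 /htP h; apply: IH; apply: leq_trans h _.
Qed.

Lemma ht_ind (P : edge G * bool -> Prop) :
  (forall d, (forall d', onward d d' -> P d') -> P d) -> forall d, P d.
Proof.
move=> step d; have [k] := ubnP (ht d); elim: k d => // k IH d /ltnSE dk.
by apply: step => d' /htP dd'; apply: IH; exact: leq_trans dd' dk.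
Qed.

Lemma beyond_onward v d d' : onward d d' -> (beyond v d' <= beyond v d)%N.
Proof. by move=> dd'; rewrite [leqRHS]beyondE (bigD1 d') //= addnCA leq_addr. Qed.

End Beyond.

Section Slopes.
Variables (R : realType) (X : hypcover R) (ht : edge (T X) * bool -> nat).
Hypothesis htP : forall d d', onward d d' -> (ht d' < ht d)%N.
Implicit Types (d : edge (T X) * bool) (u v : vertex (T X)).

Definition nbeyond d := (\sum_(i < 6) beyond ht (dbpt i) d)%N.

Lemma nbranchE u : nbranch u = (\sum_(i < 6) (u == dbpt i))%N.
Proof.
rewrite /nbranch -sum1_card big_mkcond; apply: eq_bigr => i _.
by rewrite inE eq_sym; case: eqP.
Qed.

Lemma nbeyondE d :
  nbeyond d = (nbranch (target d) + \sum_(d' | onward d d') nbeyond d')%N.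
Proof.
rewrite /nbeyond exchange_big nbranchE -big_split; apply: eq_bigr => i _.
by rewrite (beyondE htP).
Qed.

Lemma nbeyond_onward d d' : onward d d' -> (nbeyond d' <= nbeyond d)%N.
Proof. by move=> dd'; apply: leq_sum => i _; exact: beyond_onward. Qed.

Variable sl : vertex (T X) -> edge (T X) * bool -> R.
Hypothesis sl_flip : forall v d, sl v (flip d) = - sl v d.
Hypothesis sl_div : forall v u, \sum_(d | origin d == u) sl v d =
  (u == v)%:R - ((vval u)%:R - 2 + (nbranch u)%:R / 2).

Let vvalE u : vval u = (\sum_(d | origin d == u) 1)%N.
Proof. by rewrite /vval -sum1_card. Qed.

Lemma slE v d : sl v d = (nbeyond d)%:R / 2 - 1 - (beyond ht v d)%:R.
Proof.
elim/(ht_ind htP): d => d IH.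
rewrite nbeyondE beyondE //; have := sl_div v (target d).
rewrite sum_onward sl_flip (eq_bigr _ IH) !sumrB -mulr_suml -!natr_sum.
rewrite vvalE (sumn_onward (fun=> 1%N)) -(natr_sum _ _ _ (fun=> 1%N)) !natrD; lra.
Qed.

Let beyond_at v u :
  ((nbranch u + \sum_(d | origin d == u) nbeyond d)%:R =
   2 * ((u == v) + \sum_(d | origin d == u) beyond ht v d)%:R + 4 :> R).
Proof.
have := sl_div v u; rewrite (eq_bigr _ (fun d _ => slE v d)) !sumrB.
rewrite vvalE -mulr_suml -!natr_sum -(natr_sum _ _ _ (fun=> 1%N)) !natrD; lra.
Qed.

(* With [N v] the left hand side and [S] the corresponding sum of branch points,
   the slopes at [u] give [S = 2 N v + 4]; hence [N v] does not depend on [v],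
   and [S = 6 N v] as there are six branch points. *)
Lemma beyond_sum v u :
  ((u == v) + \sum_(d | origin d == u) beyond ht v d = 1)%N.
Proof.
pose N v := ((u == v) + \sum_(d | origin d == u) beyond ht v d)%N.
have NE v' : N v' = N v.
  by have := beyond_at v u; rewrite (beyond_at v') -!/(N _) => NN; apply/eqP;
    rewrite -(eqr_nat R); apply/eqP; lra.
have SE : (nbranch u + \sum_(d | origin d == u) nbeyond d = 6 * N v)%N.
  rewrite nbranchE /nbeyond exchange_big -big_split /= (eq_bigr (fun=> N v)).
    by rewrite sum_nat_const card_ord.
  by move=> i _; rewrite -(NE (dbpt i)).
have := beyond_at v u; rewrite SE -/(N v) natrM => NN; apply/eqP.
by rewrite -(eqr_nat R); apply/eqP; lra.
Qed.

Lemma nbeyond_sum u : (nbranch u + \sum_(d | origin d == u) nbeyond d = 6)%N.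
Proof.
rewrite nbranchE /nbeyond exchange_big -big_split /= (eq_bigr (fun=> 1%N)).
  by rewrite sum_nat_const card_ord.
by move=> i _; rewrite beyond_sum.
Qed.

Lemma beyond_flip v d : (beyond ht v d + beyond ht v (flip d) = 1)%N.
Proof.
rewrite -(beyond_sum v (target d)) sumn_onward [in LHS]beyondE //; lia.
Qed.

Lemma nbeyond_flip d : (nbeyond d + nbeyond (flip d) = 6)%N.
Proof.
by rewrite -big_split /= (eq_bigr _ (fun i _ => beyond_flip _ d)) sum_nat_const card_ord.
Qed.

End Slopes.

(** * Ramification *)

Section Ramification.
Variables (R : realType) (X : hypcover R).
Implicit Types (d : edge (T X) * bool) (u : vertex (T X)) (v : vertex (C X)).

Definition single_preimage u := forall v v', vmap v = u -> vmap v' = u -> v = v'.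

Definition ramified (a : edge (T X)) : bool :=
  [exists e : edge (C X), (emap e == a) && (ram e == 2%N)].

Lemma vmap_origin (e : edge (C X)) b :
  vmap (origin (e, b)) = origin (emap e, b).
Proof. by case: b; rewrite /origin /= ?vmap_src ?vmap_tgt. Qed.

Lemma vmap_surj u : exists v, vmap v = u.
Proof.
case: (pickP (fun v => vmap v == u)) => [v /eqP|fib0]; first by exists v.
by have := ldeg_sum u; rewrite big1 // => v; rewrite fib0.
Qed.

Lemma lift_halfedge v d : origin d = vmap v ->
  exists e : edge (C X), emap e = d.1 /\ origin (e, d.2) = v.
Proof.
move=> dv; case: (pickP (fun D : edge (C X) * bool =>
  (origin D == v) && ((emap D.1, D.2) == d))) => [[e b] /andP[/eqP Dv /eqP De]|no].
  by exists e; rewrite -De.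
have := Defs.harmonic dv; rewrite big_pred0 // => v0.
by have := ldeg_gt0 v; rewrite -v0.
Qed.

Lemma emap_surj (a : edge (T X)) : exists e : edge (C X), emap e = a.
Proof.
have [v va] := vmap_surj (src a).
by have [|e [ea _]] := @lift_halfedge v (a, true); [rewrite va | exists e].
Qed.

Lemma ldeg2_single_preimage v : (2 <= ldeg v)%N -> single_preimage (vmap v).
Proof.
move=> v2; suff E v' : vmap v' = vmap v -> v' = v by move=> v1 v1' /E-> /E->.
move=> v'v; apply/eqP; apply: contraTT v2 => v'nv.
have := ldeg_sum (vmap v); rewrite (bigD1 v) //= (bigD1 v') ?v'v ?eqxx //=.
by have := ldeg_gt0 v'; lia.
Qed.

Lemma ram_ldeg (e : edge (C X)) b : (ram e <= ldeg (origin (e, b)))%N.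
Proof.
rewrite -(@Defs.harmonic _ X _ (emap e, b)) ?vmap_origin //.
by rewrite (bigD1 (e, b)) ?eqxx //= leq_addr.
Qed.

Lemma ramified_single_preimage d : ramified d.1 -> single_preimage (origin d).
Proof.
case/existsP => e /andP[/eqP ed /eqP e2].
have -> : origin d = vmap (origin (e, d.2)) by rewrite vmap_origin ed -surjective_pairing.
by apply: ldeg2_single_preimage; rewrite -e2 ram_ldeg.
Qed.

Lemma branch_single_preimage u : (0 < nbranch u)%N -> single_preimage u.
Proof.
case/card_gt0P => i; rewrite inE -vmap_drpt => /eqP <-.
by apply: ldeg2_single_preimage; rewrite ldeg_drpt.
Qed.

Lemma vgenus_T u : vgenus u = 0%N.
Proof.
have /eqP := T_genus X; rewrite /genus addn_eq0 => /andP[_].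
rewrite sum_nat_eq0 => /forallP/(_ u)/implyP; rewrite /vertex_in => g0.
by apply/eqP/g0/asboolP.
Qed.

Lemma branch_parity u :
  odd (nbranch u + \sum_(d | origin d == u) ramified d.1) = false.
Proof.
have [v vu] := vmap_surj u.
have [v2|v1] := leqP 2 (ldeg v); last first.
  have nsingle : ~ single_preimage u.
    move=> uP; have := ldeg_sum u; rewrite (bigD1 v) ?vu //= big1; first by lia.
    by move=> v' /andP[/eqP v'u]; rewrite (uP v' v) ?eqxx.
  rewrite big1 => [|d /eqP du]; last first.
    by apply/eqP; rewrite eqb0; apply/negP => /ramified_single_preimage; rewrite du.
  by rewrite addn0; case: (posnP (nbranch u)) => [->//|/branch_single_preimage/nsingle].
have uP : single_preimage u by rewrite -vu; exact: ldeg2_single_preimage.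
have ldegv : ldeg v = 2%N.
  by have := ldeg_sum u; rewrite (bigD1 v) ?vu //=; lia.
have ramE : (\sum_(D : edge (C X) * bool | origin D == v) (ram D.1).-1
    = \sum_(d | origin d == u) ramified d.1)%N.
  rewrite (partition_big (fun D => (emap D.1, D.2)) (fun d => origin d == u)) /=;
    last first.
    by case=> e b /eqP Dv /=; rewrite -vmap_origin Dv vu.
  apply: eq_bigr => d /eqP du; have := Defs.harmonic (etrans du (esym vu)).
  have [/existsP[e /andP[/eqP ed /eqP e2]]|nram] := boolP (ramified d.1).
    have ev : origin (e, d.2) = v.
      by apply: uP; rewrite // vmap_origin ed -surjective_pairing.
    have e_in : (origin (e, d.2) == v) && ((emap e, d.2) == d).
      by rewrite ev ed -surjective_pairing !eqxx.
    pose P D := (origin D == v) && ((emap D.1, D.2) == d).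
    rewrite (bigD1 (P := P) (e, d.2) e_in) (bigD1 (P := P) (e, d.2) e_in) /=.
    rewrite e2 ldegv => /eqP.
    rewrite -[2%N in X in _ == X]addn0 eqn_add2l sum_nat_eq0.
    move=> /forallP rest0; rewrite big1 // => D DP.
    by have := rest0 D; rewrite DP => /eqP->.
  move=> _; rewrite big1 // => D /andP[_ /eqP Dd].
  case: (ram12 D.1) => [->//|D2].
  by case: (negP nram); apply/existsP; exists D.1; rewrite D2 -Dd /= eqxx.
have drptE : #|[pred i | drpt i == v]| = nbranch u.
  apply: eq_card => i; rewrite !inE -vmap_drpt; apply/eqP/eqP => [->//|iu].
  exact: uP.
have := riemann_hurwitz v; rewrite vgenus_T ldegv drptE.
rewrite (eq_bigr (fun D : edge (C X) * bool => ((ram D.1).-1)%:Z)); last first.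
  by move=> D _; case: (ram12 D.1) => ->.
rewrite -(big_morph Posz PoszD (erefl (Posz 0))) ramE.
move: (nbranch u) (\sum_(_ | _) _)%N (vgenus v) => a b g.
lia.
Qed.

Variable ht : edge (T X) * bool -> nat.
Hypothesis htP : forall d d', onward d d' -> (ht d' < ht d)%N.

Lemma odd_nbeyond d : odd (nbeyond ht d) = ramified d.1.
Proof.
elim/(ht_ind htP): d => d IH; have := branch_parity (target d).
rewrite sumn_onward nbeyondE // addnCA !oddD oddb /=.
suff -> : odd (\sum_(d' | onward d d') nbeyond ht d')
        = odd (\sum_(d' | onward d d') ramified d'.1).
  by case: odd; case: odd; case: ramified.
rewrite !(big_morph odd oddD (erefl (odd 0))).
by apply: eq_bigr => d' /IH ->; rewrite oddb.
Qed.

Lemma single_preimage_beyond d : (2 <= nbeyond ht d)%N -> exists d',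
  [/\ connect onward d d', (2 <= nbeyond ht d')%N & single_preimage (target d')].
Proof.
elim/(ht_ind htP): d => d IH d2.
have [/branch_single_preimage t|b0] := ltnP 0 (nbranch (target d)).
  by exists d; rewrite connect0.
case: (pickP (fun d' => onward d d' && (2 <= nbeyond ht d')%N)) => [d'|small].
  case/andP=> dd' d'2; have [d'' [d'd'' d''2 t]] := IH d' dd' d'2.
  by exists d''; split=> //; exact: connect_trans (connect1 dd') d'd''.
case: (pickP (fun d' => onward d d' && (nbeyond ht d' == 1%N))) => [d'|none].
  case/andP=> dd' /eqP d'1; exists d; split; rewrite ?connect0 //.
  case/andP: dd' => /eqP <- _; apply: ramified_single_preimage.
  by rewrite -odd_nbeyond d'1.
move: d2; rewrite nbeyondE // big1 ?addn0; first by lia.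
by move=> d' dd'; have := small d'; have := none d'; rewrite dd' /=; lia.
Qed.

End Ramification.

(** * Lifting paths to the double cover *)

Section Topology.
Variables (R : realType) (G : tropcurve R).

Lemma epoint_continuous (e : edge G) : continuous (epoint e : R -> pt G).
Proof. by apply/continuousP => A oA; exact: oA. Qed.

Lemma epoint_segment (A : set (pt G)) (e : edge G) (s t : R) :
  (forall r, Num.min s t <= r <= Num.max s t -> A (epoint e r)) ->
  connected_component A (epoint e s) (epoint e t).
Proof.
move=> stA; exists (epoint e @` `[Num.min s t, Num.max s t]).
  split.
  - by exists s; rewrite //= in_itv /= ge_min le_max lexx.
  - by move=> x [r /=]; rewrite in_itv /= => rst <-; exact: stA.
  - apply: connected_continuous_connected; first exact: segment_connected.
    by apply: continuous_subspaceT; exact: epoint_continuous.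
by exists t; rewrite //= in_itv /= ge_min le_max lexx !orbT.
Qed.

Lemma dpoint_segment (A : set (pt G)) (d : edge G * bool) (s t : R) :
  (forall r, Num.min s t <= r <= Num.max s t -> A (dpoint d r)) ->
  connected_component A (dpoint d s) (dpoint d t).
Proof.
case: d => e [] stA; apply: epoint_segment => //= r rst.
have -> : r = len e - (len e - r) by rewrite subKr.
apply: stA; move: rst; rewrite !ge_min !le_max => /andP[r1 r2].
by apply/andP; split; apply/orP; [case/orP: r2|case/orP: r1] => h;
  [left|right|left|right]; lra.
Qed.

Lemma gconnected_connected : gconnected G -> connected [set: pt G].
Proof.
move=> conn; have edge_conn (d : edge G * bool) s t :
    connected_component [set: pt G] (dpoint d s) (dpoint d t).
  exact: dpoint_segment.
have vertices u v : connected_component [set: pt G] (vpt u) (vpt v).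
  have /connectP[p pu ->] := conn u v; elim: p u pu => [|z p IH] u /=.
    by move=> _; exact: connected_component_refl.
  case/andP => /existsP[e /andP[_ /orP[]/andP[/eqP<- /eqP<-]]] /IH;
    apply: connected_component_trans.
    by rewrite -[src e]/(origin (e, true)) -[tgt e]/(target (e, true)) -dpoint0 -dpoint_len.
  by rewrite -[src e]/(origin (e, true)) -[tgt e]/(target (e, true)) -dpoint0 -dpoint_len.
have to_vertex (x : pt G) : exists v, connected_component [set: pt G] x (vpt v).
  case: x => [v|[e u]]; first by exists v; exact: connected_component_refl.
  by exists (src e); rewrite -epoint_inr -(epoint_le0 e (lexx 0)); exact: epoint_segment.
have [[x _]|none] := pselect ([set: pt G] !=set0); last first.
  rewrite (_ : [set: pt G] = set0); first exact: connected0.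
  by apply/seteqP; split=> // x _; apply: none; exists x.
rewrite (_ : [set: pt G] = connected_component [set: pt G] x);
  first exact: component_connected.
apply/seteqP; split=> // y _; have [u xu] := to_vertex x; have [v yv] := to_vertex y.
apply: connected_component_trans xu _; apply: connected_component_trans (vertices u v) _.
exact: connected_component_sym.
Qed.

Definition coords (x : pt G) : option (edge G * R) :=
  match x with inl _ => None | inr (existT e t) => Some (e, val t) end.

Lemma coords_dpoint (d : edge G * bool) t : 0 < t < len d.1 ->
  coords (dpoint d t) = Some (d.1, if d.2 then t else len d.1 - t).
Proof.
case: d => e b te; have te' : 0 < (if b then t else len e - t) < len e.
  by move: te; case: b => /=; lra.
by rewrite /dpoint (epoint_interior te').
Qed.

End Topology.

Section Lifting.
Variables (R : realType) (X : hypcover R).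
Implicit Types (d : edge (T X) * bool) (z : pt (T X)) (p : pt (C X)).

Lemma ram_gt0 (e : edge (C X)) : 0 < (ram e)%:R :> R.
Proof. by case: (ram12 e) => ->. Qed.

Lemma trop_dpoint (e : edge (C X)) b t : 0 <= t <= len e ->
  trop (dpoint (e, b) t) = dpoint (emap e, b) ((ram e)%:R * t).
Proof.
case/andP; rewrite !le_eqVlt => /predU1P[<- _|t0 /predU1P[->|tl]].
- by rewrite mulr0 !dpoint0 /= vmap_origin.
- rewrite -[len e]/(len (e, b).1) dpoint_len -len_emap.
  by rewrite -[len _]/(len (emap e, b).1) dpoint_len /= vmap_origin.
have te' : 0 < (if b then t else len e - t) < len e by case: b; lra.
rewrite {1}/dpoint (epoint_interior te') /=.
by rewrite /dpoint /= len_emap; case: b {te'}; rewrite // mulrBr.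
Qed.

Lemma lift_point p d s : 0 <= s <= len d.1 -> trop p = dpoint d s ->
  exists e t, [/\ emap e = d.1, 0 <= t <= len e, p = dpoint (e, d.2) t &
                  s = (ram e)%:R * t].
Proof.
have vptC u : coords (G := T X) (vpt u) = None by [].
case: p => [v|[e u]] /= sd pd.
  case/andP: sd; rewrite !le_eqVlt => /predU1P[s0 _|s0 /predU1P[sl|sl]].
  - move: pd; rewrite -s0 dpoint0 => -[dv].
    have [e [ed ev]] := lift_halfedge (esym dv).
    by exists e, 0; rewrite lexx ltW ?len_gt0 // mulr0 -ev dpoint0.
  - move: pd; rewrite sl dpoint_len => -[dv].
    have [e [ed ev]] := lift_halfedge (d := flip d) (esym dv).
    have {}ed : emap e = d.1 by [].
    exists e, (len e); rewrite lexx ltW ?len_gt0 // -ed len_emap.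
    by split=> //; rewrite -[len e]/(len (e, d.2).1) dpoint_len /target -ev.
  - by have := vptC (vmap v); rewrite pd coords_dpoint ?s0.
have /andP[u0 ul] := valP u; have r0 := ram_gt0 e.
have ue : 0 < (ram e)%:R * val u < len (emap e, true).1.
  by rewrite mulr_gt0 //= len_emap ltr_pM2l.
have := coords_dpoint ue; rewrite [dpoint _ _]pd.
move: sd => /andP; rewrite !le_eqVlt => -[/predU1P[<- _|s0 /predU1P[->|sl]]].
- by rewrite dpoint0.
- by rewrite dpoint_len.
rewrite coords_dpoint ?s0 // => -[ed su].
exists e, (if d.2 then val u else len e - val u); split=> //.
- by move: (val u) u0 ul => x ? ?; case: d.2; lra.
- by rewrite /dpoint /=; case: d.2; rewrite ?subKr epoint_inr.
- rewrite -[sval u]/(val u) in su; move: (val u) su => x; case: d.2 => [//|].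
  by rewrite mulrBr -len_emap -ed => <-; rewrite subKr.
Qed.

Definition lifts (K : set (pt (T X))) z z' := forall p, trop p = z ->
  exists2 p', trop p' = z' & connected_component (@trop R X @^-1` K) p p'.

Lemma lifts_refl K z : K z -> lifts K z z.
Proof.
by move=> Kz p pz; exists p => //; apply: connected_component_refl; rewrite /= pz.
Qed.

Lemma lifts_trans K z1 z2 z3 : lifts K z1 z2 -> lifts K z2 z3 -> lifts K z1 z3.
Proof.
move=> l12 l23 p /l12[p' /l23[p'' p''z p'p''] pp'].
by exists p'' => //; exact: connected_component_trans pp' p'p''.
Qed.

Lemma lifts_segment (K : set (pt (T X))) d s t :
  0 <= s <= len d.1 -> 0 <= t <= len d.1 ->
  (forall r, Num.min s t <= r <= Num.max s t -> K (dpoint d r)) ->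
  lifts K (dpoint d s) (dpoint d t).
Proof.
move=> sd td stK p /(lift_point sd)[e [s' [ed s'e -> ss']]].
have r0 := ram_gt0 e; have rne : (ram e)%:R != 0 :> R by rewrite gt_eqF.
have dE : d = (emap e, d.2) by rewrite ed -surjective_pairing.
have t'e : 0 <= t / (ram e)%:R <= len e.
  move: td; rewrite -ed len_emap => /andP[t0 tl].
  by rewrite divr_ge0 ?ler0n //= ler_pdivrMr // mulrC.
exists (dpoint (e, d.2) (t / (ram e)%:R)).
  by rewrite trop_dpoint // -dE mulrC divfK.
apply: dpoint_segment => r /=; rewrite ge_min le_max => /andP[r1 r2].
rewrite trop_dpoint -?dE; last first.
  move: s'e t'e => /andP[a1 a2] /andP[b1 b2]; apply/andP; split.
    by case/orP: r1; exact: le_trans.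
  by case/orP: r2 => /le_trans; apply.
apply: stK; rewrite ge_min le_max ss' !(ler_pM2l r0).
by move: r1 r2; rewrite ler_pdivrMr // ler_pdivlMr // [r * _]mulrC => -> ->.
Qed.

Lemma connected_lifts (K : set (pt (T X))) q :
  (forall z, K z -> lifts K z q) ->
  (forall p p' : pt (C X), trop p = q -> trop p' = q -> p = p') ->
  connected (@trop R X @^-1` K).
Proof.
move=> Kq qP; have [[p0 Kp0]|none] := pselect (exists p, K (@trop R X p)); last first.
  rewrite (_ : _ @^-1` _ = set0); first exact: connected0.
  by apply/seteqP; split=> // p Kp; apply: none; exists p.
have [q' q'q p0q'] := Kq _ Kp0 p0 erefl.
have -> : @trop R X @^-1` K = connected_component (@trop R X @^-1` K) q'.
  apply/seteqP; split; last exact: connected_component_sub.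
  move=> p Kp; have [q'' q''q pq''] := Kq _ Kp p erefl.
  by apply: connected_component_sym; rewrite (qP q' q'').
exact: component_connected.
Qed.

End Lifting.

(** * The divisor D at points where lambda is positive *)

Lemma near_pos (R : realType) (a b : R) : 0 < a ->
  \forall eps \near 0^'+, 0 < a + b * eps.
Proof.
move=> a0; have b1 : 0 < `|b| + 1 by rewrite ltr_wpDl.
near=> eps.
have eps0 : 0 < eps by near: eps; exact: nbhs_right_gt.
have : eps < a / (`|b| + 1).
  by near: eps; apply: nbhs_right_lt; rewrite divr_gt0.
rewrite ltr_pdivlMr // => epsa.
have : - (`|b| * eps) <= b * eps by rewrite -mulNr ler_pM2r // lerNl ler_normr lexx orbT.
by move: epsa; rewrite mulrDr mulrC; lra.
Unshelve. all: by end_near. Qed.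

Section Lambda.
Variables (R : realType) (X : hypcover R).
Variable ls : vertex (T X) -> pt (T X) -> R.
Hypothesis ls_admissible : forall v, admissible v (ls v).
Implicit Types (d : edge (T X) * bool) (u v : vertex (T X)) (y z : pt (T X)).

Lemma trop_surj z : exists p, @trop R X p = z.
Proof.
case: z => [u|[a w]]; first by have [v <-] := vmap_surj u; exists (vpt v).
have [e ea] := emap_surj a; case: a / ea w => w; have /andP[w0 wl] := valP w.
exists (dpoint (e, true) (val w / (ram e)%:R)); rewrite trop_dpoint.
  by rewrite mulrC divfK ?gt_eqF ?ram_gt0 // /dpoint epoint_inr.
by rewrite divr_ge0 ?ler0n ?ltW //= ltr_pdivrMr ?ram_gt0 // mulrC -len_emap.
Qed.

Lemma lambdaT_ge rho z : 0 < rho ->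
  rho <= lambdaT ls z <-> exists v, rho <= ls v z.
Proof.
move=> rho0; split=> [/bigmax_geP[|[v _ vz]]|[v vz]]; last 2 first.
- by exists v.
- by apply/bigmax_geP; right; exists v.
- by rewrite leNgt rho0.
Qed.

Lemma le_lambdaT v z : ls v z <= lambdaT ls z.
Proof. exact: le_bigmax. Qed.

Lemma lambdaT_active z : 0 < lambdaT ls z -> exists v, ls v z = lambdaT ls z.
Proof.
move=> z0; have [v vz] := (lambdaT_ge z z0).1 (lexx _); exists v.
by apply/eqP; rewrite eq_le vz le_lambdaT.
Qed.

Lemma DeltaT_pos z : 0 < lambdaT ls z -> DeltaT ls z.
Proof.
move=> z0; have [p pz] := trop_surj z; exists p => // A [_ sA]; apply: sA.
by apply: subset_closure; rewrite /= /lambda pz.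
Qed.

Variables (ht : edge (T X) * bool -> nat) (sl : vertex (T X) -> edge (T X) * bool -> R).
Hypothesis htP : forall d d', onward d d' -> (ht d' < ht d)%N.
Hypothesis lsE : forall v d (t : R), 0 <= t <= len d.1 ->
  ls v (dpoint d t) = ls v (dpoint d 0) + sl v d * t.
Hypothesis sl_flip : forall v d, sl v (flip d) = - sl v d.
Hypothesis sl_div : forall v u, \sum_(d | origin d == u) sl v d =
  (u == v)%:R - ((vval u)%:R - 2 + (nbranch u)%:R / 2).

Lemma ls_move v y d : tangent y d ->
  \forall eps \near 0^'+, ls v (move y d eps) = ls v y + sl v d * eps.
Proof.
case/tangent_dpoint => t [/andP[t0 tl] yt ymove]; near=> eps.
have eps0 : 0 < eps by near: eps; exact: nbhs_right_gt.
have epsl : eps < len d.1 - t by near: eps; apply: nbhs_right_lt; rewrite subr_gt0.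
rewrite ymove yt (@lsE v d t) ?(@lsE v d (t + eps)); lra.
Unshelve. all: by end_near. Qed.

Lemma slope_ls v y d : tangent y d -> slope (ls v) y d = sl v d.
Proof. by move=> /(ls_move v)/slope_eq. Qed.

Lemma D_pos y : 0 < lambdaT ls y ->
  D ls y = Dprime [set: _] y + \sum_(d | tangent y d) slope (lambdaT ls) y d.
Proof.
move=> y0; have tangentE : tangent_in (DeltaT ls) y =1 tangent y.
  move=> d; rewrite /tangent_in; case yd: (tangent y d) => //=; apply: asboolT.
  have [v vy] := lambdaT_active y0; rewrite -vy in y0; near=> eps.
  apply: DeltaT_pos; apply: lt_le_trans (le_lambdaT v _).
  rewrite (near (ls_move v yd) eps) //; near: eps; exact: near_pos.
rewrite /D /div_in (eq_bigl _ _ tangentE); congr (_ + _).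
rewrite /Dprime cut_ramifiedT; congr (_%:R - _ + (_ + _)%:R / _).
  by apply: eq_card => d; rewrite !inE tangentE tangent_inT.
by apply: eq_card0 => d; rewrite !inE tangentE; case: tangent.
Unshelve. all: by end_near. Qed.

Lemma beyond_tangent v y :
  ((y == vpt v) + \sum_(d | tangent y d) beyond ht v d = 1)%N.
Proof.
case: y => [u|[e w]] /=; first exact: (beyond_sum htP sl_flip sl_div).
by rewrite sum_edge -(beyond_flip htP sl_flip sl_div v (e, true)).
Qed.

(* If all functions realising the maximum at [y] had their base vertex beyond
   the same direction [d], they would coincide near [y] and the maximum would be
   one of the [ls v] there, whose [D] vanishes at [y]. *)
Lemma special_active y d : 0 < lambdaT ls y -> D ls y <> 0 -> tangent y d ->
  exists2 v, ls v y = lambdaT ls y & beyond ht v d = 0%N.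
Proof.
move=> y0 Dy yd; apply: contrapT => noact; apply: Dy.
have active_beyond v : ls v y = lambdaT ls y -> [/\ y == vpt v = false,
    beyond ht v d = 1%N & forall d', tangent y d' -> d' != d -> beyond ht v d' = 0%N].
  move=> vy; have /eqP : beyond ht v d <> 0%N by move=> v0; apply: noact; exists v.
  rewrite -lt0n => v0; have := beyond_tangent v y; rewrite (bigD1 d) //= => sum1.
  split; [by move: sum1; case: eqP => //; lia | by lia | move=> d' yd' dd'].
  by move: sum1; rewrite (bigD1 d') ?yd' //=; lia.
have [v vy] := lambdaT_active y0; have [nyv vd1 vd0] := active_beyond v vy.
have slopeE d' : tangent y d' -> slope (lambdaT ls) y d' = slope (ls v) y d'.
  move=> yd'; rewrite slope_ls //; apply: slope_eq.
  have : \forall eps \near 0^'+, forall v', ls v' (move y d' eps) <= ls v (move y d' eps).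
    apply: filter_forall => v'.
    have [v'y|v'y] := eqVneq (ls v' y) (lambdaT ls y).
      have sl' : sl v' d' = sl v d'.
        rewrite !(slE htP sl_flip sl_div); have [_ v'd1 v'd0] := active_beyond v' v'y.
        by have [->|dd'] := eqVneq d' d; rewrite ?vd1 ?v'd1 // vd0 // v'd0.
      near=> eps; rewrite (near (ls_move v yd') eps) // (near (ls_move v' yd') eps) //.
      by rewrite sl' v'y vy.
    have : 0 < ls v y - ls v' y by rewrite subr_gt0 vy lt_neqAle v'y le_lambdaT.
    move=> /(near_pos (sl v d' - sl v' d')) pos.
    near=> eps; rewrite (near (ls_move v yd') eps) // (near (ls_move v' yd') eps) //.
    have : 0 < ls v y - ls v' y + (sl v d' - sl v' d') * eps by near: eps.
    by rewrite mulrBl; lra.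
  move=> maxv; near=> eps; rewrite -vy -(near (ls_move v yd') eps) //.
  apply/eqP; rewrite eq_le le_lambdaT andbT; apply: bigmax_le => [|v' _]; last first.
    exact: (near maxv eps).
  apply: ltW; rewrite (near (ls_move v yd') eps) //; near: eps.
  by apply: near_pos; rewrite vy.
rewrite D_pos // (eq_bigr _ slopeE); have [_ /(_ y)] := ls_admissible v.
by rewrite /div_in (eq_bigl _ _ (tangent_inT _)) nyv.
Unshelve. all: by end_near. Qed.

End Lambda.

(** * Connectedness of the superlevel set *)

Section Walk.
Variables (R : realType) (X : hypcover R).
Variable ls : vertex (T X) -> pt (T X) -> R.
Hypothesis ls_admissible : forall v, admissible v (ls v).
Variables (ht : edge (T X) * bool -> nat) (sl : vertex (T X) -> edge (T X) * bool -> R).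
Hypothesis htP : forall d d', onward d d' -> (ht d' < ht d)%N.
Hypothesis lsE : forall v d (t : R), 0 <= t <= len d.1 ->
  ls v (dpoint d t) = ls v (dpoint d 0) + sl v d * t.
Hypothesis sl_flip : forall v d, sl v (flip d) = - sl v d.
Hypothesis sl_div : forall v u, \sum_(d | origin d == u) sl v d =
  (u == v)%:R - ((vval u)%:R - 2 + (nbranch u)%:R / 2).
Variable y : pt (T X).
Hypotheses (y_gt0 : 0 < lambdaT ls y) (Dy : D ls y <> 0).
Implicit Types (d : edge (T X) * bool) (u v : vertex (T X)) (z : pt (T X)).

Let K := [set z | lambdaT ls y <= lambdaT ls z].

Let KP z : K z <-> exists v, lambdaT ls y <= ls v z.
Proof. exact: lambdaT_ge. Qed.

Let ls_le v d s t : 0 <= s -> s <= t -> t <= len d.1 ->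
  ((2 <= nbeyond ht d)%N -> beyond ht v d = 0%N ->
     ls v (dpoint d s) <= ls v (dpoint d t)) /\
  ((nbeyond ht d <= 2)%N -> ls v (dpoint d t) <= ls v (dpoint d s)).
Proof.
move=> s0 st tl; rewrite (@lsE v d s) ?(@lsE v d t); try lra.
rewrite !lerD2l (slE htP sl_flip sl_div); split=> [b2 ->|b2].
  by apply: ler_wpM2l => //; move: b2; rewrite -(ler_nat R) subr0; lra.
apply: ler_wnM2l => //; have := ler0n R (beyond ht v d).
by move: b2; rewrite -(ler_nat R); lra.
Qed.

(* The invariant carried along the geodesics issuing from [y]. *)
Let reach d s := [/\ 0 <= s <= len d.1,
  (2 <= nbeyond ht d)%N -> lifts K y (dpoint d s) /\
     exists2 v, beyond ht v d = 0%N & lambdaT ls y <= ls v (dpoint d s) &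
  K (dpoint d s) -> lifts K (dpoint d s) y].

Let reach_edge d s t : reach d s -> s <= t <= len d.1 -> reach d t.
Proof.
move=> [sin out back] /andP[st tl]; have /andP[s0 _] := sin.
have tin : 0 <= t <= len d.1 by rewrite tl (le_trans s0 st).
have seg : (forall r, s <= r <= t -> K (dpoint d r)) ->
    lifts K (dpoint d s) (dpoint d t) /\ lifts K (dpoint d t) (dpoint d s).
  move=> segK; split; apply: lifts_segment => //.
    by rewrite (min_idPl st) (max_idPr st).
  by rewrite minC maxC (min_idPl st) (max_idPr st).
split=> // [b2|].
  have [ys [v v0 vs]] := out b2.
  have up r : s <= r <= t -> lambdaT ls y <= ls v (dpoint d r).
    move=> /andP[sr rt]; apply: le_trans vs _.
    by have [/(_ b2 v0)] := @ls_le v d s r s0 sr (le_trans rt tl).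
  split; last by exists v => //; apply: up; rewrite st lexx.
  by apply: (lifts_trans ys); apply: (seg _).1 => r /up rK; apply/KP; exists v.
move=> Kt; suff segK r : s <= r <= t -> K (dpoint d r).
  by apply: lifts_trans (seg segK).2 (back _); apply: segK; rewrite lexx st.
move=> /andP[sr rt]; apply/KP; have [b2|b2] := leqP 2 (nbeyond ht d).
  have [_ [v v0 vs]] := out b2; exists v; apply: le_trans vs _.
  by have [/(_ b2 v0)] := @ls_le v d s r s0 sr (le_trans rt tl).
have [v vt] := (KP _).1 Kt; exists v; apply: le_trans vt _.
by have [_ /(_ (ltnW b2))] := @ls_le v d r t (le_trans s0 sr) rt tl.
Qed.

Let reach_onward d d' : reach d (len d.1) -> onward d d' -> reach d' 0.
Proof.
move=> [_ out back] dd'; have /andP[/eqP d'd _] := dd'.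
have d'0 : dpoint d' 0 = dpoint d (len d.1) by rewrite dpoint0 dpoint_len d'd.
split; rewrite ?d'0 // ?lexx ?ltW ?len_gt0 // => b2.
have [|yd [v v0 vd]] := out; first exact: leq_trans b2 (nbeyond_onward htP dd').
split=> //; exists v => //; apply/eqP; rewrite -leqn0 -v0.
exact: beyond_onward.
Qed.

Let reach_tangent d s : tangent y d -> 0 <= s <= len d.1 -> y = dpoint d s -> reach d s.
Proof.
move=> yd sd ys; have Ky : K y by rewrite /K /=.
split=> // [_|_]; rewrite -ys; last exact: lifts_refl.
split; first exact: lifts_refl.
by have [v vy vd] := special_active ls_admissible htP lsE sl_flip sl_div y_gt0 Dy yd;
  exists v; rewrite // vy.
Qed.

Let reach_connect d s d' : reach d s -> connect onward d d' -> d' = d \/ reach d' 0.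
Proof.
move=> ds /connectP[p dp ->].
elim: p d s ds dp => [|d1 p IH] d s ds /=; first by left.
case/andP => dd1 d1p; right; have sd : 0 <= s <= len d.1 by case: ds.
have d10 : reach d1 0.
  by apply: reach_onward dd1; apply: reach_edge ds _; move: sd; rewrite lexx => /andP[_ ->].
by case: (IH _ _ d10 d1p) => [->|].
Qed.

Let beyond_connect u d : (0 < beyond ht u d)%N ->
  exists2 d', connect onward d d' & target d' = u.
Proof.
elim/(ht_ind htP): d => d IH; rewrite beyondE //.
have [<- _|_] := eqVneq (target d) u; first by exists d; rewrite ?connect0.
rewrite add0n lt0n sum_nat_eq0 negb_forall => /existsP[d1].
rewrite negb_imply -lt0n => /andP[dd1 /(IH _ dd1)[d' d1d' d'u]].
by exists d' => //; exact: connect_trans (connect1 dd1) d1d'.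
Qed.

Let reach_vertex u : y = vpt u \/ exists d s,
  [/\ reach d s, target d = u & s = 0 \/ y = dpoint d s /\ 0 <= s < len d.1].
Proof.
have := beyond_tangent htP sl_flip sl_div u y.
have [->|_] := eqVneq y (vpt u); first by left.
rewrite add0n => sum1; right.
have [d yd ud] : exists2 d, tangent y d & (0 < beyond ht u d)%N.
  apply: contrapT => none; move: sum1; rewrite big1 // => d yd.
  by apply/eqP; rewrite -leqn0 leqNgt; apply/negP => ud; apply: none; exists d.
have [s [sd ys _]] := tangent_dpoint yd.
have /andP[s0 /ltW sl_] := sd; have sd' : 0 <= s <= len d.1 by rewrite s0.
have ds := reach_tangent yd sd' ys.
have [d' dd' d'u] := beyond_connect ud.
case: (reach_connect ds dd') => [d'd|]; last by exists d', 0; split=> //; left.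
by exists d, s; split=> //; [rewrite -d'd|right].
Qed.

Let reach_all z : z = y \/ exists d t, reach d t /\ z = dpoint d t.
Proof.
case: z => [u|[a w]].
  case: (reach_vertex u) => [->|[d [s [ds du _]]]]; first by left.
  right; exists d, (len d.1); rewrite dpoint_len du; split=> //.
  by apply: reach_edge (ds) _; case: ds => /andP[_ ->]; rewrite lexx.
have /andP[w0 wl] := valP w; right.
have zt : inr (existT _ a w) = dpoint (a, true) (val w) by rewrite /dpoint epoint_inr.
have zf : inr (existT _ a w) = dpoint (a, false) (len a - val w).
  by rewrite /dpoint /= subKr epoint_inr.
have [[w' yw]|ya] := pselect (exists w', y = inr (existT _ a w')).
  have /andP[w'0 w'l] := valP w'.
  have [ww'|/ltW ww'] := leP (val w') (val w).
    exists (a, true), (val w); split=> //; apply: (@reach_edge _ (val w')).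
      by apply: reach_tangent; rewrite ?yw //= ?ltW // /dpoint epoint_inr.
    by rewrite ww' ltW.
  exists (a, false), (len a - val w); split=> //.
  apply: (@reach_edge _ (len a - val w')).
    apply: reach_tangent; rewrite ?yw //=; last by rewrite /dpoint /= subKr epoint_inr.
    by rewrite subr_ge0 gerBl !ltW.
  by rewrite lerD2l lerN2 ww' gerBl ltW.
case: (reach_vertex (src a)) => [yu|[d [s [ds da s0]]]].
  exists (a, true), (val w); split=> //; apply: (@reach_edge _ 0).
    apply: reach_tangent; rewrite ?lexx ?ltW ?len_gt0 //; first by rewrite yu /= eqxx.
    by rewrite dpoint0.
  by rewrite !ltW.
have [daf|daf] := eqVneq d (a, false).
  exists d, (len a - val w); split; last by rewrite daf.
  apply: reach_edge (ds) _; rewrite daf /= gerBl (ltW w0) andbT.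
  case: s0 => [->|[ys sd]]; first by rewrite subr_ge0 ltW.
  move: sd => /andP; rewrite le_eqVlt => -[/predU1P[<- _|s0 sl_]].
    by rewrite subr_ge0 ltW.
  have sd : 0 < len d.1 - s < len d.1 by rewrite subr_gt0 sl_ gtrBl.
  case: ya; rewrite ys daf /dpoint /=; rewrite daf /= in sd.
  by rewrite (epoint_interior sd); eexists.
exists (a, true), (val w); split=> //; apply: (@reach_edge _ 0); last by rewrite !ltW.
apply: (@reach_onward d); last first.
  by rewrite /onward da eqxx; apply: contra daf => /eqP af; rewrite -(flipK d) -af.
by apply: reach_edge (ds) _; case: ds => /andP[_ ->]; rewrite lexx.
Qed.

Let reach_single_preimage d : tangent y d -> (2 <= nbeyond ht d)%N ->
  exists2 u, lifts K y (vpt u) & single_preimage u.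
Proof.
move=> yd /(single_preimage_beyond htP)[d' [dd' d'2 d't]]; exists (target d') => //.
have [s [/andP[s0 /ltW sl_] ys _]] := tangent_dpoint yd.
have ds : reach d s by apply: reach_tangent; rewrite ?s0.
have [_ out _] : reach d' (len d'.1).
  case: (reach_connect ds dd') => [->|d'0].
    by apply: reach_edge ds _; rewrite sl_ lexx.
  by apply: reach_edge d'0 _; rewrite lexx ltW ?len_gt0.
by rewrite -dpoint_len; have [] := out d'2.
Qed.

Let lifts_single_preimage : exists2 u, lifts K y (vpt u) & single_preimage u.
Proof.
have [[d yd d2]|small] := pselect (exists2 d, tangent y d & (2 <= nbeyond ht d)%N).
  exact: reach_single_preimage d2.
case E : y => [u|[a w]]; last first.
  case: small; have := nbeyond_flip htP sl_flip sl_div (a, true).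
  have [b2 _|b2 b6] := leqP 2 (nbeyond ht (a, true)).
    by exists (a, true); rewrite // E /=.
  by exists (flip (a, true)); [rewrite E /=|lia].
rewrite -E; have yu : lifts K y (vpt u) by rewrite {1}E; apply: lifts_refl; rewrite /K /= E.
exists u => //; have := nbeyond_sum htP sl_flip sl_div u.
have [b0|/branch_single_preimage//] := posnP (nbranch u).
have [[d du d1]|none] := pselect (exists2 d, origin d = u & nbeyond ht d = 1%N).
  by rewrite -du => _; apply: ramified_single_preimage; rewrite -(odd_nbeyond htP) d1.
rewrite b0 big1 // => d /eqP du; apply/eqP; rewrite -leqn0 leqNgt; apply/negP => d0.
have [d1|d1] := leqP 2 (nbeyond ht d); first by case: small; exists d; rewrite // E /= du.
by apply: none; exists d => //; lia.
Qed.

Lemma connected_superlevel : connected [set p | lambdaT ls y <= lambda ls p].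
Proof.
have [u yu ut] := lifts_single_preimage.
apply: (@connected_lifts _ _ K (vpt u)) => [z Kz|p p'].
  apply: lifts_trans yu; case: (reach_all z) => [zy|[d [t [[_ _ back] zt]]]].
    by rewrite -zy in Kz *; exact: lifts_refl.
  by rewrite zt; apply: back; rewrite -zt.
have pre (p0 : pt (C X)) : trop p0 = vpt u -> exists2 v, p0 = vpt v & vmap v = u.
  case: p0 => [v [vu]|[e w]]; first by exists v.
  have /andP[w0 wl] := valP w.
  have we : 0 < (ram e)%:R * val w < len (emap e).
    by rewrite len_emap mulr_gt0 ?ram_gt0 //= ltr_pM2l ?ram_gt0.
  by rewrite /= (epoint_interior we).
by move=> /pre[v -> vu] /pre[v' -> v'u]; rewrite (ut v v').
Qed.

End Walk.

Theorem lemma3p21 (R : realType) (X : hypcover R)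
  (w : vertex (C X) -> nat) (weight_w : is_weight w)
  (ls : vertex (T X) -> pt (T X) -> R)
  (ls_admissible : forall v0, admissible v0 (ls v0))
  (ls_normalized : forall v0, normalized w (fun x => ls v0 (trop x)))
  (rho1 : R) (rho1_special : special_value ls rho1) :
  connected [set x : pt (C X) | rho1 <= lambda ls x].
Proof.
case: rho1_special => x [_ Dx] <-.
have [x0|x0] := ltP 0 (lambda ls x); last first.
  rewrite (_ : [set _ | _] = [set: pt (C X)]); last first.
    by apply/seteqP; split=> // z _ /=; apply: le_trans x0 _; exact: bigmax_ge_id.
  exact: gconnected_connected (@C_connected _ X).
have [ht htP] := tree_height (@T_connected _ X) (T_genus X) (dbpt ord0).
have /choice[sl slP] := fun v => admissible_affine (ls_admissible v).
apply: (connected_superlevel ls_admissible htP (sl := sl)) => // v.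
- by case: (slP v).
- by case: (slP v).
- by case: (slP v).
Qed.
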